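(* Let $E$ be a real normed vector space of finite dimension $\dim_{\mathbb R}E=e\ge 1$, let $\Lambda\subseteq E$ be a lattice, let $d>1$ be an integer, and let $T=T_{d,m,r}\colon\Lambda\to\Lambda$ be a generalized Collatz mapping of relatively prime type. Assume that $$\prod_{\omega\in\Lambda/d\Lambda}m_\omega<d^{\,d^e}.$$ Then the set $\mathrm{Stop}(T)$ of points of $\Lambda$ with finite stopping time for $T$ has asymptotic density $\delta(\mathrm{Stop}(T))=1$.
   Context: A lattice $\Lambda\subseteq E$ is a full-rank lattice, i.e. the $\mathbb Z$-span of an $\mathbb R$-basis of $E$. Generalized Collatz mapping: for every coset $\omega\in\Lambda/d\Lambda$ one chooses an integer $m_\omega>0$ and a vector $r_\omega\in\Lambda$ with $m_\omega\omega+r_\omega\equiv 0 \bmod d\Lambda$ (i.e. $m_\omega x+r_\omega\in d\Lambda$ for all $x\in\omega$), and defines $T(x)=\frac1d(m_\omega x+r_\omega)$ for $x\in\omega$. $T$ is of relatively prime type if $\gcd(d,m_\omega)=1$ for all $\omega\in\Lambda/d\Lambda$. A point $x\in\Lambda$ has finite stopping time for $T$ if there is an integer $k>1$ with $\|T^k(x)\|<\|x\|$, where $\|\cdot\|$ is the norm of $E$. Let $\beta(\rho)$ be the closed ball of radius $\rho$ around $0$ in $E$. For $Z\subseteq\Lambda$ put $\underline\delta(Z)=\liminf_{n\to\infty}\frac{|Z\cap\beta(n)|}{|\Lambda\cap\beta(n)|}$ and $\overline\delta(Z)=\limsup_{n\to\infty}\frac{|Z\cap\beta(n)|}{|\Lambda\cap\beta(n)|}$;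 if they agree, the common value is the asymptotic density $\delta(Z)$. *)

(* Defs.v *)
(* MathComp-Analysis; R : realType plays the role of the real numbers. *)
From HB Require Import structures.
From mathcomp Require Import all_boot all_order all_algebra.
From mathcomp Require Import finmap.
From mathcomp Require Import all_classical all_reals.
From mathcomp Require Import ereal topology normedtype sequences.

Set Implicit Arguments.
Unset Strict Implicit.
Unset Printing Implicit Defensive.

Import Order.TTheory GRing.Theory Num.Theory.
Import numFieldNormedType.Exports.

Local Open Scope classical_set_scope.
Local Open Scope ring_scope.

(* Finite-dimensional normed spaces: [vectType] supplies the dimension
   [\dim {:E}] and bases of E, [normedModType] an arbitrary norm. *)
#[short(type="normedVectType")]
HB.structure Definition NormedVector (R : numFieldType) :=
  {E of Vector R E & NormedModule R E}.

Section Collatz.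
Context {R : realType} {E : normedVectType R}.
Implicit Types (L Z : set E) (d : nat) (x : E) (m : set E -> nat)
  (r : set E -> E).

Definition is_lattice L : Prop :=
  exists2 b : (\dim {:E}).-tuple E,
    basis_of {:E} b & L = [set x | inIntSpan b x].

Definition dilate L d : set E := [set y *+ d | y in L].

Definition coset L d x : set E := [set x + y | y in dilate L d].

(* L / dL, as the set of cosets x + dL with x in L. It is finite when L is a
   lattice and d > 0, so a [\big[op/idx]_(w \in quotient L d) F w] is then a
   genuine product, not the default [idx] used for infinite supports. *)
Definition quotient L d : set (set E) := [set coset L d x | x in L].

(* [m] and [r] are total functions on sets, but only their values on the
   elements of [quotient L d] matter. *)
Definition collatz_data L d m r : Prop :=
  forall w, quotient L d w ->
    [/\ (0 < m w)%N, L (r w) & forall x, w x -> dilate L d (x *+ m w + r w)].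

(* For x in L, [coset L d x] is the class of x, and T x is again in L when
   [collatz_data L d m r] holds; the values outside of L are never used. *)
Definition collatz L d m r x : E :=
  d%:R^-1 *: (x *+ m (coset L d x) + r (coset L d x)).

Definition relatively_prime_type L d m : Prop :=
  forall w, quotient L d w -> coprime d (m w).

Definition finite_stopping_time (T : E -> E) x : Prop :=
  exists2 k : nat, (1 < k)%N & `|iter k T x| < `|x|.

Definition stop L (T : E -> E) : set E :=
  [set x | L x /\ finite_stopping_time T x].

(* Z is meant to be a subset of a lattice, so that the intersection is finite;
   [fset_set] of an infinite set would be empty. [closed_ball_ Num.norm 0 n] is
   [set x | `|0 - x| <= n]. *)
Definition count_in_ball Z (n : nat) : nat :=
  #|` fset_set (Z `&` closed_ball_ Num.norm 0 n%:R) |.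

Definition ball_ratio L Z (n : nat) : R :=
  (count_in_ball Z n)%:R / (count_in_ball L n)%:R.

Definition lower_density L Z : \bar R :=
  limn_einf (fun n => (ball_ratio L Z n)%:E).

Definition upper_density L Z : \bar R :=
  limn_esup (fun n => (ball_ratio L Z n)%:E).

Definition has_density L Z (a : R) : Prop :=
  lower_density L Z = a%:E /\ upper_density L Z = a%:E.

End Collatz.

(* Main.v *)
Require Import Defs.
From mathcomp Require Import all_boot all_order all_algebra.
From mathcomp Require Import finmap.
From mathcomp Require Import all_classical all_reals.
From mathcomp Require Import ereal topology normedtype sequences.
From mathcomp Require Import derive exp.
From mathcomp Require Import ring lra zify.

Set Implicit Arguments.
Unset Strict Implicit.
Unset Printing Implicit Defensive.

Import Order.TTheory GRing.Theory Num.Theory.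
Import numFieldNormedType.Exports.

Local Open Scope classical_set_scope.
Local Open Scope ring_scope.

(** Write [e] for the dimension, [d^e = #|L / dL|], and call the sequence of
cosets of [x, T x, ..., T^(k-1) x] the itinerary of [x]; let [M] be the product
of the corresponding multipliers. Up to a bounded error, [T^k] stretches [x] by
the factor [M / d^k], so outside of a ball every [x] with [M < d^k] has finite
stopping time ([stop_far]). It remains to see that the [x] with [M >= d^k] are
rare when [k] is large.

No itinerary is much more frequent than the others. If [x] and [y] have the same itinerary, then
[d^k (T^k x - T^k y) = M (x - y)], and since [M] is prime to [d^k] this forces
[x - y] into [d^k L] ([iter_collatzB], [dilate_coprime]). Thus each itinerary
is realised inside a single class modulo [d^k L], and it is enough to bound the
number of itineraries with [M >= d^k]. The hypothesis on the product of the
multipliers says that [ln (m_w / d)] has negative mean over [w] in [L / dL],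
and a Chernoff bound shows that the proportion of those words among all
[d^(e k)] is at most [q^k] for some [q < 1] ([card_words_ge]).

Passing from classes to balls needs no volume asymptotics. Translating a set
that meets at most [N] classes modulo [D L] by the [D^e] vectors of a
fundamental box covers each lattice point at most [N] times, whence
[D^e * #(X in ball rho) <= N * #(L in ball (rho + const))] ([count_packing]).
The fixed enlargement of the ball costs at most a factor [2^e] for large radii:
covering [L] by the [2^e] classes modulo [2 L] bounds the number of points in a
ball by [2^e] times that in a ball of half the radius plus a constant
([count_scale], [count_shift]). Hence the points without finite stopping time
have upper density at most [2^e q^k] for all [k > 1], which is zero. *)

(** * A Chernoff bound for words *)

(** The quadratic bound comes from [exp u <= 1 / (1 - u)], which is the
inequality [1 - u <= exp (- u)]. *)
Lemma expR_le_quad (R : realType) (u : R) : `|u| <= 2^-1 ->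
  expR u <= 1 + u + 2 * u ^+ 2.
Proof.
rewrite ler_norml => /andP[ul uu].
have u1 : 0 < 1 - u by lra.
have eu : expR u <= (1 - u)^-1.
  rewrite -[u in expR u]opprK expRN lef_pV2 ?posrE ?expR_gt0//.
  exact: expR_ge1Dx.
apply: le_trans eu _; rewrite -[leLHS]mulr1 ler_pdivrMl//; nra.
Qed.

(** At [t = 0] the sum of exponentials equals the cardinal of [W] and its
derivative in [t] is the sum of the [y w], which is negative. *)
Lemma sum_expR_lt_card (R : realType) (W : finType) (y : W -> R) :
  \sum_w y w < 0 ->
  exists2 t : R, 0 < t & \sum_w expR (t * y w) < #|W|%:R.
Proof.
set s := \sum_w y w => s0.
pose A := \sum_w `|y w|; pose S := \sum_w y w ^+ 2.
have S0 : 0 <= S by apply: sumr_ge0 => w _; exact: sqr_ge0.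
have yA w : `|y w| <= A.
  by rewrite /A (bigD1 w)//= lerDl sumr_ge0.
have sA : - s <= A.
  by rewrite (le_trans (ler_norm _))// normrN; exact: ler_norm_sum.
have A0 : 0 < A by rewrite (lt_le_trans _ sA)// oppr_gt0.
(* Small enough for [`|t * y w| <= 1/2] and for the quadratic term
   [2 * t^2 * S] to stay below the linear gain [- t * s]. *)
pose t := - s / (2 * (A + 1) * (S + A)).
have t0 : 0 < t by rewrite divr_gt0 ?oppr_gt0// !mulr_gt0//; lra.
have tA : t * A <= 2^-1.
  rewrite /t mulrAC ler_pdivrMr ?mulr_gt0//; [nra|lra|lra].
have tS : 2 * t * S < - s.
  have -> : 2 * t * S = - s * (S / ((A + 1) * (S + A))).
    rewrite /t; field; apply/andP; split; lra.
  rewrite -[ltRHS]mulr1 ltr_pM2l ?oppr_gt0// ltr_pdivrMr ?mul1r; nra.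
exists t => //.
apply: (@le_lt_trans _ _ (\sum_w (1 + t * y w + 2 * (t * y w) ^+ 2))).
  apply: ler_sum => w _; apply: expR_le_quad.
  rewrite normrM gtr0_norm// (le_trans _ tA)// ler_pM2l//.
rewrite !big_split /= sumr_const -mulr_sumr -/s.
under [X in _ + X]eq_bigr do rewrite exprMn.
rewrite -!mulr_sumr -/S -addrA gtrDl; nra.
Qed.

(** Markov's inequality for the product weights
[\prod_i (mu (u i) / d) ^ t]: each word that is counted has weight at least
[1], while the weights of all words of length [k] sum to the [k]-th power of
[\sum_w (mu w / d) ^ t], which is below [#|W|] for a suitable [t > 0]. *)
Lemma card_words_ge (R : realType) (W : finType) (mu : W -> nat) (d : nat) :
  (0 < d)%N -> (forall w, 0 < mu w)%N -> (\prod_w mu w < d ^ #|W|)%N ->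
  exists q : R, [/\ 0 <= q, q < 1 & forall k,
   #|[set u : {ffun 'I_k -> W} | (d ^ k <= \prod_i mu (u i))%N]%SET|%:R
     <= q ^+ k * (#|W| ^ k)%:R].
Proof.
move=> d0 mu0 mulog.
pose y w : R := ln ((mu w)%:R / d%:R).
have yE w : expR (y w) = (mu w)%:R / d%:R.
  by rewrite lnK// posrE divr_gt0 ?ltr0n.
have s0 : \sum_w y w < 0.
  rewrite -expR_lt1 expR_sum; under eq_bigr do rewrite yE.
  rewrite prodf_div prodr_const -natr_prod -natrX.
  by rewrite ltr_pdivrMr ?mul1r ?ltr_nat// ltr0n expn_gt0 d0.
have [t t0 tW] := sum_expR_lt_card s0.
have W0 : 0 < #|W|%:R :> R.
  by apply: le_lt_trans tW; apply: sumr_ge0 => w _; exact: expR_ge0.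
exists ((\sum_w expR (t * y w)) / #|W|%:R); split.
- by rewrite divr_ge0// sumr_ge0// => w _; exact: expR_ge0.
- by rewrite ltr_pdivrMr// mul1r.
move=> k; rewrite natrX -exprMn divfK ?gt_eqF//.
rewrite -[X in _ ^+ X]card_ord -prodr_const bigA_distr_bigA /=.
rewrite -sum1_card natr_sum [leLHS]big_mkcond /=.
apply: ler_sum => u _; rewrite inE; case: ifPn => uk; last first.
  by rewrite prodr_ge0// => i _; exact: expR_ge0.
rewrite -expR_sum -mulr_sumr -[leLHS]expR0 ler_expR mulr_ge0 ?(ltW t0)//.
rewrite leNgt -expR_lt1 -leNgt expR_sum; under eq_bigr do rewrite yE.
rewrite prodf_div prodr_const -natr_prod -natrX card_ord.
by rewrite ler_pdivlMr ?mul1r ?ler_nat// ltr0n expn_gt0 d0.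
Qed.

(** * Lattice points in balls *)

(** All norms are equivalent in finite dimension: the norm of a linear
combination of [b], as a function of the coordinates, is continuous and positive
on the compact unit sphere, hence at least a positive constant there. It follows that lattice
points in a ball have bounded coordinates. *)
Lemma free_coord_bound (R : realType) (E : normedVectType R) n
    (b : n.-tuple E) : free b ->
  exists2 c : R, 0 <= c & forall (a : 'rV[R]_n) i,
    `|a ord0 i| <= c * `|\sum_(j < n) a ord0 j *: b`_j|.
Proof.
move=> fb; pose F (a : 'rV[R]_n) : E := \sum_(j < n) a ord0 j *: b`_j.
have cF : continuous (fun a => `|F a|).
  move=> a; apply: (@continuous_comp _ _ _ F (fun x : E => `|x|)).
    apply: continuous_big => [|j _]; first exact: add_continuous.
    move=> {}a; apply: continuousZr_tmp.
    exact: coord_continuous.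
  exact: norm_continuous.
have FZ k a : F (k *: a) = k *: F a.
  by rewrite /F scaler_sumr; apply: eq_bigr => j _; rewrite mxE scalerA.
have F0 a : F a = 0 -> a = 0.
  move=> Fa0; apply/rowP => i; rewrite mxE.
  by have /freeP/(_ (fun i => a ord0 i)) := fb; apply.
have coord_le (a : 'rV[R]_n) i : `|a ord0 i| <= `|a|.
  rewrite [leRHS]/Num.norm /= mx_normrE; apply/bigmax_geP; right.
  by exists (ord0, i).
pose S := [set a : 'rV[R]_n | `|a| = 1].
have [S0|S0] := pselect (S !=set0); last first.
  exists 0 => // a i; rewrite mul0r (le_trans (coord_le a i))//.
  have [->|a0] := eqVneq a 0; first by rewrite normr0.
  exfalso; apply: S0; exists (`|a|^-1 *: a).
  by rewrite /S/= normrZ normfV normr_id mulVf ?normr_eq0.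
have cS : compact S.
  apply: bounded_closed_compact.
    exists 1; split=> //= x x1 a; rewrite /S/= => ->; exact: ltW.
  have -> : S = (fun a : 'rV[R]_n => `|a|) @^-1` [set 1] by [].
  apply: preimage_closed; last exact: closed_eq.
  by move=> a _; exact: norm_continuous.
have [|c cS1 cmin] := EVT_min_rV S0 cS (f := fun a => `|F a|).
  exact: continuous_subspaceT.
have Fc0 : 0 < `|F c|.
  rewrite normr_gt0; apply/eqP => /F0 c0; move: cS1.
  by rewrite inE /S /= c0 normr0 => /esym/eqP; rewrite oner_eq0.
exists `|F c|^-1 => [|a i]; first by rewrite invr_ge0.
rewrite (le_trans (coord_le a i))// -/(F a).
have [->|a0] := eqVneq a 0.
  by rewrite normr0 mulr_ge0// invr_ge0.
rewrite ler_pdivlMl// mulrC -ler_pdivlMl ?normr_gt0//.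
have := cmin (`|a|^-1 *: a); rewrite FZ normrZ normfV normr_id; apply.
by rewrite inE /S /= normrZ normfV normr_id mulVf ?normr_eq0.
Qed.

Lemma closed_ball0P (R : realType) (E : normedVectType R) (rho : R) (x : E) :
  closed_ball_ Num.norm 0 rho x <-> `|x| <= rho.
Proof. by rewrite /closed_ball_ /= sub0r normrN. Qed.

Section Lattice.
Context {R : realType} {E : normedVectType R} (b : (\dim {:E}).-tuple E).
Context (bP : basis_of {:E} b).
Local Notation e := (\dim {:E}).
Let L : set E := [set x | inIntSpan b x].

Lemma intSpan0 : L 0.
Proof. by exists [ffun=> 0]; rewrite big1 // => i _; rewrite ffunE mulr0z. Qed.

Lemma intSpanD x y : L x -> L y -> L (x + y).
Proof.
move=> [a ->] [a' ->]; exists [ffun i => a i + a' i].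
by rewrite -big_split; apply: eq_bigr => i _; rewrite ffunE mulrzDr.
Qed.

Lemma intSpanMz x z : L x -> L (x *~ z).
Proof.
move=> [a ->]; exists [ffun i => a i * z]; rewrite mulrz_suml.
by apply: eq_bigr => i _; rewrite ffunE mulrzA.
Qed.

Lemma intSpanB x y : L x -> L y -> L (x - y).
Proof. by move=> Lx /(@intSpanMz _ (-1)); rewrite mulrN1z; apply: intSpanD. Qed.

Lemma finite_intSpan_ball (rho : R) :
  finite_set (L `&` closed_ball_ Num.norm 0 rho).
Proof.
have /andP[_ fb] := bP.
have [c c0 cP] := free_coord_bound fb.
pose N := Num.bound (c * rho).
pose f (g : {ffun 'I_e -> 'I_(N + N).+1}) : E :=
  \sum_(i < e) b`_i *~ ((g i)%:Z - N%:Z).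
apply: (@sub_finite_set _ _ (f @` [set: _])); last exact: finite_image.
move=> _ [[a ->] /closed_ball0P xrho].
have aN i : (absz (a i) <= N)%N.
  have := cP (\row_j (a j)%:~R) i; rewrite mxE.
  under eq_bigr do rewrite mxE scaler_int.
  move=> /le_trans/(_ (ler_wpM2l c0 xrho)) aicrho.
  rewrite -(ler_nat R) natr_absz -intr_norm in aicrho *.
  by rewrite (le_trans aicrho)// ltW// archi_boundP// (le_trans _ aicrho).
exists [ffun i => inord (absz (a i + N%:Z))] => //; apply: eq_bigr => i _.
rewrite ffunE inordK; last by rewrite ltnS; have := aN i; lia.
by congr (_ *~ _); have := aN i; lia.
Qed.

(** The points of the fundamental box of [D L], which represent the classes of
[L / D L]. *)
Definition box D (f : {ffun 'I_e -> 'I_D}) : E := \sum_(i < e) b`_i *+ f i.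

Lemma box_in D f : L (box (D:=D) f).
Proof.
by exists [ffun i => (f i)%:Z]; apply: eq_bigr => i _; rewrite ffunE.
Qed.

Lemma norm_box D f : `|box (D:=D) f| <= (\sum_(i < e) `|b`_i|) *+ D.
Proof.
rewrite -sumrMnl; apply: le_trans (ler_norm_sum _ _ _) _.
by apply: ler_sum => i _; rewrite normrMn ler_wpMn2l// ltnW.
Qed.

Lemma box_inj D (f g : {ffun 'I_e -> 'I_D}) :
  dilate L D (box f - box g) -> f = g.
Proof.
have /andP[_ /freeP fb] := bP.
move=> [_ [a ->] /esym/eqP]; rewrite -subr_eq0 /box -sumrB -sumrMnl -sumrB.
move=> /eqP h; apply/ffunP => i; apply/val_inj => /=.
have /eqP : ((f i)%:Z - (g i)%:Z - a i * D%:Z)%:~R = 0 :> R.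
  apply: (fb (fun i => ((f i)%:Z - (g i)%:Z - a i * D%:Z)%:~R)) => //.
  rewrite -[RHS]h; apply: eq_bigr => j _.
  by rewrite scaler_int !mulrzBr mulrzA -!pmulrn.
rewrite intr_eq0 => /eqP; have := ltn_ord (f i); have := ltn_ord (g i).
have : a i = 0 \/ (1 <= a i \/ a i <= -1) by lia.
by move=> [->|[|]]; nia.
Qed.

Lemma box_surj D x : (0 < D)%N -> L x ->
  exists f : {ffun 'I_e -> 'I_D}, exists2 y, L y & x = box f + y *+ D.
Proof.
move=> D0 [a ->].
exists [ffun i => insubd (Ordinal D0) `|(a i %% D)%Z|%N].
exists (\sum_(i < e) b`_i *~ (a i %/ D)%Z).
  by exists [ffun i => (a i %/ D)%Z]; apply: eq_bigr => i _; rewrite ffunE.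
rewrite -sumrMnl -big_split; apply: eq_bigr => i _ /=.
have D0z : 0 < D%:Z by [].
have am := modz_ge0 (a i) (lt0r_neq0 D0z).
rewrite !ffunE insubdK; last first.
  by rewrite -topredE /= -ltz_nat gez0_abs// ltz_pmod.
by rewrite !pmulrn -mulrzA -mulrzDr gez0_abs// addrC -divz_eq.
Qed.

(** [count_in_ball] with a real radius, because the estimates shift and rescale
the ball. *)
Definition ball_count (Z : set E) (rho : R) : nat :=
  #|` fset_set (Z `&` closed_ball_ Num.norm 0 rho)|.

Let kappa : R := \sum_(i < e) `|b`_i|.

Lemma finite_sub_ball Z rho : Z `<=` L ->
  finite_set (Z `&` closed_ball_ Num.norm 0 rho).
Proof.
by move=> ZL; apply: sub_finite_set (finite_intSpan_ball rho); exact: setSI.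
Qed.

Lemma leq_count Z Z' rho rho' : Z' `<=` L -> Z `<=` Z' -> rho <= rho' ->
  (ball_count Z rho <= ball_count Z' rho')%N.
Proof.
move=> Z'L ZZ' rr; apply/fsubset_leq_card; rewrite -fset_set_sub.
- apply: setISS => // x /closed_ball0P xr.
  by apply/closed_ball0P; exact: le_trans rr.
- by apply: finite_sub_ball; exact: subset_trans Z'L.
- exact: finite_sub_ball.
Qed.

(** The map sending [(f, x)] to [(phi x, x + box f)] is injective: two
preimages of one pair have [phi x = phi y], so that [x - y], and hence the
difference of the boxes, lies in [D L]; the boxes then agree. *)
Lemma count_packing D (P : finType) (A : {set P}) (phi : E -> P) X rho :
  X `<=` L -> (forall x, X x -> phi x \in A) ->
  (forall x y, X x -> X y -> phi x = phi y -> dilate L D (x - y)) ->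
  (D ^ e * ball_count X rho <= #|A| * ball_count L (rho + kappa *+ D))%N.
Proof.
move=> XL XA phiD.
pose s := [seq (phi x, x + box f) | f <- enum {: {ffun 'I_e -> 'I_D}},
   x <- fset_set (X `&` closed_ball_ Num.norm 0 rho)].
pose t := [seq (p, y) | p <- enum A,
   y <- fset_set (L `&` closed_ball_ Num.norm 0 (rho + kappa *+ D))].
have -> : (D ^ e * ball_count X rho = size s)%N.
  by rewrite size_allpairs -cardE card_ffun !card_ord.
have -> : (#|A| * ball_count L (rho + kappa *+ D) = size t)%N.
  by rewrite size_allpairs -cardE.
have memX x : x \in fset_set (X `&` closed_ball_ Num.norm 0 rho) ->
    X x /\ `|x| <= rho.
  rewrite in_fset_set ?inE; last exact: finite_sub_ball.
  by move=> [? /closed_ball0P].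
apply: uniq_leq_size.
  apply: allpairs_uniq; [exact: enum_uniq|exact: fset_uniq|].
  move=> u v /allpairsP[[f x] /= [_ /memX[Xx _] ->]].
  move=> /allpairsP[[g y] /= [_ /memX[Xy _] ->]] /= [phixy xy].
  have /eqP fg : f == g.
    apply/eqP/box_inj; have -> : box f - box g = y - x.
      by rewrite -[box f](addKr x) xy addrA addrK addrC.
    exact: phiD.
  by move: xy; rewrite fg => /addIr ->.
move=> _ /allpairsP[[f x] /= [_ /memX[Xx xrho] ->]].
apply/allpairsP; exists (phi x, x + box f); split=> //=.
  by rewrite mem_enum XA.
rewrite in_fset_set ?inE; last exact: finite_sub_ball.
split; first exact/intSpanD/box_in/XL.
by apply/closed_ball0P/(le_trans (ler_normD _ _))/lerD/norm_box.
Qed.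

(** Each lattice point is [box f + y *+ D], where the norm of [y] is about
[1 / D] times that of the point. *)
Lemma count_scale D t : (0 < D)%N ->
  (ball_count L (t *+ D) <= D ^ e * ball_count L (t + kappa))%N.
Proof.
move=> D0.
pose s := [seq box f + y *+ D | f <- enum {: {ffun 'I_e -> 'I_D}},
   y <- fset_set (L `&` closed_ball_ Num.norm 0 (t + kappa))].
have -> : (D ^ e * ball_count L (t + kappa) = size s)%N.
  by rewrite size_allpairs -cardE card_ffun !card_ord.
apply: uniq_leq_size => [|x]; first exact: fset_uniq.
rewrite in_fset_set ?inE; last exact: finite_sub_ball.
move=> [/(box_surj D0)[f [y Ly ->]] /closed_ball0P xt].
apply/allpairsP; exists (f, y); split=> //=; first by rewrite mem_enum.
rewrite in_fset_set ?inE; last exact: finite_sub_ball.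
split=> //; apply/closed_ball0P.
rewrite -(ler_pMn2r D0) -normrMn mulrnDl.
rewrite -[y *+ D](addKr (box f)) addrC (le_trans (ler_normB _ _))//.
by rewrite lerD// norm_box.
Qed.

(** A bounded enlargement of a large ball multiplies the number of its lattice
points by at most a constant: the larger ball eventually has less than twice
the radius, and doubling the radius is [count_scale] with [D = 2]. *)
Lemma count_shift s : exists n0 : nat, forall n : nat, (n0 <= n)%N ->
  (ball_count L (n%:R + s) <= 2 ^ e * ball_count L n%:R)%N.
Proof.
(* The radius [n] is written as [(n - kappa) + kappa], and twice [n - kappa]
   is at least [n + s] as soon as [n >= s + 2 kappa]. *)
exists (Num.bound `|s + kappa *+ 2|) => n n0n.
have sn : s + kappa *+ 2 <= n%:R.
  rewrite (le_trans (ler_norm _))// (le_trans (ltW (archi_boundP _)))//.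
  by rewrite ler_nat.
have -> : n%:R = (n%:R - kappa) + kappa by rewrite subrK.
rewrite (leq_trans _ (count_scale (n%:R - kappa) (ltn0Sn 1)))//.
by apply: leq_count => //; move: sn; rewrite subrK mulrnBl !mulr2n; lra.
Qed.

(** Packing applied to the single point [0] yields [N ^ e] points in a ball of
radius proportional to [N]. *)
Lemma count_unbounded (N : nat) : (0 < e)%N -> exists n0 : nat, forall n : nat,
  (n0 <= n)%N -> (N <= ball_count L n%:R)%N.
Proof.
move=> e0; exists (Num.bound (kappa *+ N)) => n n0n.
have cN : (ball_count L (0 + kappa *+ N) <= ball_count L n%:R)%N.
  apply: leq_count => //; rewrite add0r.
  rewrite (le_trans (ltW (archi_boundP _)))//.
    by rewrite mulrn_wge0// sumr_ge0.
  by rewrite ler_nat.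
apply: leq_trans cN.
have /(_ [set: unit]%SET (fun=> tt) [set 0] 0) := @count_packing N unit.
rewrite cardsT card_unit mul1n => pack.
apply: leq_trans (pack _ _ _) => //.
- rewrite (leq_trans _ (leq_pmulr _ _))//.
    by case: (N) => // N'; rewrite -{1}[N'.+1]expn1 leq_pexp2l.
  rewrite /ball_count cardfs_gt0; apply/fset0Pn; exists 0.
  rewrite in_fset_set ?inE; last exact: finite_setIl.
  by split=> //; apply/closed_ball0P; rewrite normr0.
- by move=> _ ->; exact: intSpan0.
- by move=> x y -> -> _; exists 0; [exact: intSpan0|rewrite mul0rn subrr].
Qed.

(** * Itineraries of the Collatz mapping *)

Section Dynamics.
Context (d : nat) (d_gt1 : (1 < d)%N) (m : set E -> nat) (r : set E -> E).
Context (mrP : collatz_data L d m r) (cop : relatively_prime_type L d m).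
Local Notation T := (collatz L d m r).
Local Notation W := {ffun 'I_e -> 'I_d}.

Let d_gt0 : (0 < d)%N := ltnW d_gt1.

Lemma dilate0 D : dilate L D 0.
Proof. by exists 0; [exact: intSpan0|rewrite mul0rn]. Qed.

Lemma dilateD D x y : dilate L D x -> dilate L D y -> dilate L D (x + y).
Proof.
move=> [u Lu <-] [v Lv <-].
by exists (u + v); [exact: intSpanD|rewrite mulrnDl].
Qed.

Lemma dilateB D x y : dilate L D x -> dilate L D y -> dilate L D (x - y).
Proof.
move=> [u Lu <-] [v Lv <-].
by exists (u - v); [exact: intSpanB|rewrite mulrnBl].
Qed.

Lemma coset_mem x : coset L d x x.
Proof. by exists 0; [exact: dilate0|rewrite addr0]. Qed.

Lemma coset_eq x y : dilate L d (x - y) -> coset L d x = coset L d y.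
Proof.
move=> xy; apply/seteqP; split => _ [z dz <-].
  by exists (x - y + z); [exact: dilateD|rewrite addrA subrKC].
by exists (z - (x - y)); [exact: dilateB|rewrite opprB addrCA subrKC addrC].
Qed.

Lemma coset_eqP x y : coset L d x = coset L d y -> dilate L d (x - y).
Proof.
move=> xy; have := coset_mem x; rewrite xy => -[z dz <-].
by rewrite addrC addKr.
Qed.

Lemma quotient_box_bij :
  set_bij [set: W] (quotient L d) (fun f => coset L d (box f)).
Proof.
split=> [f _|f g _ _ /coset_eqP/box_inj //|_ [x Lx <-]].
  by exists (box f) => //; exact: box_in.
have [f [y Ly ->]] := box_surj d_gt0 Lx; exists f => //.
by apply/esym/coset_eq; exists y => //; rewrite addrC addKr.
Qed.

(** The product over [L / dL] becomes a product over box representatives, a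
finite type of cardinal [d ^ e]. *)
Lemma prod_quotient :
  (\big[muln/1%N]_(w \in quotient L d) m w =
   \prod_(f : W) m (coset L d (box f)))%N.
Proof.
rewrite (reindex_fsbig _ _ _ _ quotient_box_bij).
rewrite (fsbigE (index_enum W)) ?index_enum_uniq//; last first.
  by move=> f _; rewrite mem_index_enum.
by apply: eq_bigl => f; exact: mem_set.
Qed.

Lemma quotient_coset x : L x -> quotient L d (coset L d x).
Proof. by exists x. Qed.

Lemma collatz_mulrn x :
  T x *+ d = x *+ m (coset L d x) + r (coset L d x).
Proof. by rewrite -scaler_nat scalerA mulfV ?scale1r// pnatr_eq0 -lt0n. Qed.

Lemma collatz_in x : L x -> L (T x).
Proof.
move=> Lx; have [_ _ /(_ _ (coset_mem x))[y Ly]] := mrP (quotient_coset Lx).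
have d0 : d%:R != 0 :> R by rewrite pnatr_eq0 -lt0n.
rewrite -collatz_mulrn -[LHS]scaler_nat -[RHS]scaler_nat => yT.
by rewrite -(scalerI d0 yT).
Qed.

Lemma iter_collatz_in k x : L x -> L (iter k T x).
Proof. by move=> Lx; elim: k => //= k; exact: collatz_in. Qed.

Definition multiplier k x := (\prod_(i < k) m (coset L d (iter i T x)))%N.

(** On points with a common itinerary the iterates are the same affine map, so
the translation parts cancel. *)
Lemma iter_collatzB k x y : L x -> L y ->
  (forall i, (i < k)%N -> coset L d (iter i T x) = coset L d (iter i T y)) ->
  (iter k T x - iter k T y) *+ d ^ k = (x - y) *+ multiplier k x.
Proof.
move=> Lx Ly; elim: k => [|k IH] xy.
  by rewrite /multiplier big_ord0 expn0.
rewrite /multiplier big_ord_recr /= mulrnA -IH; last first.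
  by move=> i ik; exact/xy/ltnW.
rewrite expnS mulrnA mulrnBl !collatz_mulrn xy//.
by rewrite opprD addrACA subrr addr0 -mulrnBl mulrnAC.
Qed.

Lemma coprime_multiplier k x : L x -> coprime (d ^ k) (multiplier k x).
Proof.
move=> Lx; rewrite coprimeXl// /multiplier.
elim/big_ind: _ => [|a c da dc|i _]; first exact: coprimen1.
  by rewrite coprimeMr da.
exact/cop/quotient_coset/iter_collatz_in.
Qed.

(** Bezout: with [km * D = kn * M + 1] one gets
[z = (z *+ km - u *+ kn) *+ D]. *)
Lemma dilate_coprime D M z u : (0 < D)%N -> coprime D M -> L z -> L u ->
  u *+ D = z *+ M -> dilate L D z.
Proof.
move=> D0 /eqP DM Lz Lu uz; case: (egcdnP M D0) => km kn; rewrite DM => kE _.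
exists (z *~ km%:Z - u *~ kn%:Z); first by apply: intSpanB; exact: intSpanMz.
rewrite -!pmulrn mulrnBl -!mulrnA kE [(kn * D)%N]mulnC [u *+ _]mulrnA uz.
by rewrite -mulrnA mulnC mulrnDr mulr1n addrC addKr.
Qed.

(** The error term comes from the finitely many translation vectors; one step
multiplies the previous error by at most the largest multiplier. *)
Lemma norm_iter_collatz k : exists C : R, forall x, L x ->
  `|iter k T x| <= (multiplier k x)%:R / (d ^ k)%:R * `|x| + C.
Proof.
pose M := (\sum_(f : W) m (coset L d (box f)))%N.
pose Q := \sum_(f : W) `|r (coset L d (box f))|.
have [mM rQ] : (forall x, L x -> (m (coset L d x) <= M)%N) /\
    (forall x, L x -> `|r (coset L d x)| <= Q).
  split=> x /quotient_coset; have [_ _ /[apply]] := quotient_box_bij.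
    by move=> [f _ <-]; rewrite /M (bigD1 f)//= leq_addr.
  by move=> [f _ <-]; rewrite /Q (bigD1 f)//= lerDl sumr_ge0.
have step x : L x -> `|T x| <= (m (coset L d x))%:R / d%:R * `|x| + Q.
  move=> Lx; rewrite /collatz normrZ normfV normr_nat.
  have dR : 1 <= d%:R :> R by rewrite ler1n.
  rewrite ler_pdivrMl ?(lt_le_trans ltr01)// (le_trans (ler_normD _ _))//.
  rewrite normrMn mulrDr mulrA mulrCA mulfV; last first.
    by rewrite gt_eqF// (lt_le_trans ltr01).
  rewrite mulr1 -(mulr_natl `|x|).
  by rewrite lerD// (le_trans (rQ _ Lx))// ler_peMl// /Q sumr_ge0.
elim: k => [|k [C IH]].
  by exists 0 => x _; rewrite /multiplier big_ord0 expn0 divr1 mul1r addr0.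
exists (M%:R * `|C| + Q) => x Lx /=.
rewrite (le_trans (step _ (iter_collatz_in k Lx)))// addrA lerD2r.
set mk := m _.
have mkM : mk%:R <= M%:R :> R by rewrite ler_nat; exact/mM/iter_collatz_in.
have dR : 1 <= d%:R :> R by rewrite ler1n.
have d0 : 0 < d%:R :> R by rewrite (lt_le_trans ltr01).
have mk0 : 0 <= mk%:R / d%:R :> R by rewrite divr_ge0.
apply: (le_trans (ler_wpM2l mk0 (IH _ Lx))).
rewrite mulrDr lerD//.
  rewrite /multiplier big_ord_recr /= -/mk natrM expnS natrM invfM.
  rewrite le_eqVlt; apply/orP; left; apply/eqP; ring.
rewrite (le_trans (ler_norm _))// normrM ger0_norm// ler_wpM2r//.
by rewrite (le_trans _ mkM)// ler_pdivrMr// ler_peMr.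
Qed.

(** For integers, [M < d^k] gives [M / d^k <= 1 - 1 / d^k], so the gain
[`|x| / d^k] beats the error [C] once [`|x| > d^k * C]. *)
Lemma stop_far k : (1 < k)%N -> exists rho : R, forall x, L x ->
  (multiplier k x < d ^ k)%N -> rho < `|x| -> finite_stopping_time T x.
Proof.
move=> k1; have [C HC] := norm_iter_collatz k.
exists ((d ^ k)%:R * C) => x Lx Mx Cx; exists k => //.
apply: le_lt_trans (HC _ Lx) _.
have D0 : 0 < (d ^ k)%:R :> R by rewrite ltr0n expn_gt0 d_gt0.
have MD : (multiplier k x)%:R + 1 <= (d ^ k)%:R :> R by rewrite natr1 ler_nat.
rewrite mulrAC -ltrBrDr ltr_pdivrMr// mulrBl.
have := normr_ge0 x; nra.
Qed.

(** * Density of the stopping set *)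

Lemma count_setU X Y rho : X `<=` L -> Y `<=` L ->
  (ball_count (X `|` Y) rho <= ball_count X rho + ball_count Y rho)%N.
Proof.
move=> XL YL; rewrite /ball_count setIUl fset_setU; [|exact: finite_sub_ball..].
exact: leq_card_fsetU.
Qed.

Lemma count_setD X Z rho : X `<=` L -> Z `<=` X ->
  ball_count X rho = (ball_count Z rho + ball_count (X `\` Z) rho)%N.
Proof.
move=> XL ZX; rewrite /ball_count.
set B := closed_ball_ _ _ _.
have -> : (X `\` Z) `&` B = (X `&` B) `\` (Z `&` B).
  apply/seteqP; split=> x; first by move=> [[Xx nZx] Bx]; split=> // -[].
  by move=> [[Xx Bx] nZBx]; split=> //; split=> // Zx; exact: nZBx.
have finX : finite_set (X `&` B) by exact: finite_sub_ball.
have finZ : finite_set (Z `&` B) by apply: sub_finite_set finX; exact: setSI.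
rewrite fset_setD// -(cardfsID (fset_set (Z `&` B))) -fset_setI//.
suff -> : X `&` B `&` (Z `&` B) = Z `&` B by [].
by apply/setIidr; exact: setSI.
Qed.

(** Packing modulo [d ^ k] with the itinerary as class function: points with
equal itineraries are congruent, and the number of itineraries with a large
multiplier is at most [q ^ k] times the number [(d ^ k) ^ e] of classes. *)
Lemma count_large_multiplier :
  (\prod_(f : W) m (coset L d (box f)) < d ^ (d ^ e))%N ->
  exists q : R, [/\ 0 <= q, q < 1 & forall k rho,
    (ball_count [set x | L x /\ (d ^ k <= multiplier k x)%N] rho)%:R
      <= q ^+ k * (ball_count L (rho + kappa *+ d ^ k))%:R].
Proof.
have cardW : #|W| = (d ^ e)%N by rewrite card_ffun !card_ord.
rewrite -cardW => mulog.
have mu0 f : (0 < m (coset L d (@box d f)))%N.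
  by have [] := mrP (quotient_coset (box_in f)).
have [q [q0 q1 qP]] := card_words_ge R d_gt0 mu0 mulog.
exists q; split=> // k rho.
have /choice[digit digitP] x : exists f : W,
    L x -> coset L d x = coset L d (box f).
  have [Lx|] := pselect (L x); last by exists [ffun=> Ordinal d_gt0].
  have [_ _ /(_ _ (quotient_coset Lx))[f _ fx]] := quotient_box_bij.
  by exists f.
pose word x : {ffun 'I_k -> W} := [ffun i : 'I_k => digit (iter i T x)].
have dk0 : (0 < d ^ k)%N by rewrite expn_gt0 d_gt0.
set X := [set x | _].
have XL : X `<=` L by move=> x [].
pose A := [set u : {ffun 'I_k -> W} |
  (d ^ k <= \prod_i m (coset L d (box (u i))))%N]%SET.
have XA x : X x -> word x \in A.
  move=> [Lx]; rewrite inE /multiplier; congr (_ <= _)%N; apply: eq_bigr => i _.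
  by rewrite ffunE -digitP//; exact: iter_collatz_in.
have Xword x y : X x -> X y -> word x = word y -> dilate L (d ^ k) (x - y).
  move=> [Lx _] [Ly _] xy.
  have Lxy := intSpanB (iter_collatz_in k Lx) (iter_collatz_in k Ly).
  apply: dilate_coprime dk0 (coprime_multiplier k Lx) (intSpanB Lx Ly) Lxy _.
  apply: iter_collatzB => // i ik.
  have /ffunP/(_ (Ordinal ik)) := xy; rewrite !ffunE /= => xyi.
  rewrite (digitP _ (iter_collatz_in i Lx)) xyi.
  exact: esym (digitP _ (iter_collatz_in i Ly)).
have pack := count_packing rho XL XA Xword.
have De0 : 0 < ((d ^ k) ^ e)%:R :> R by rewrite ltr0n expn_gt0 dk0.
rewrite -(ler_pM2l De0) -natrM.
apply: le_trans (_ : _ <= (#|A| * ball_count L (rho + kappa *+ d ^ k))%:R) _.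
  by rewrite ler_nat.
rewrite natrM mulrA ler_wpM2r// mulrC.
by have := qP k; rewrite cardW expnAC.
Qed.

(** Half of [eps] pays for the points with a large multiplier, after choosing
[k] with [q ^ k * 2 ^ e <= eps / 2]; the other half pays for the fixed ball
left out by [stop_far], which is negligible as the number of lattice points
tends to infinity. *)
Lemma count_nonstop : (0 < e)%N ->
  (\prod_(f : W) m (coset L d (box f)) < d ^ (d ^ e))%N ->
  forall eps : R, 0 < eps -> exists n0 : nat, forall n : nat, (n0 <= n)%N ->
    (ball_count (L `\` stop L T) n%:R)%:R <= eps * (ball_count L n%:R)%:R.
Proof.
move=> e0 /count_large_multiplier[q [q0 q1 qP]] eps eps0.
have [k k1 qk] : exists2 k, (1 < k)%N & q ^+ k * (2 ^ e)%:R <= eps / 2.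
  have c0 : 0 < eps / 2 / (2 ^ e)%:R by rewrite !divr_gt0// ltr0n expn_gt0.
  have /cvgrPdist_le/(_ _ c0)[k0 _ k0P] : q ^+ n @[n --> \oo] --> 0.
    by apply: cvg_expr; rewrite ger0_norm.
  exists (maxn k0 2); first by rewrite leq_maxr.
  have := k0P (maxn k0 2) (leq_maxl _ _).
  rewrite /= sub0r normrN ger0_norm ?exprn_ge0// => h.
  by rewrite -ler_pdivlMr// ltr0n expn_gt0.
have [rho rhoP] := stop_far k1.
have [n1 n1P] := count_shift (kappa *+ d ^ k).
have [n2 n2P] :=
  count_unbounded (Num.bound ((ball_count L rho)%:R * (eps / 2)^-1)) e0.
exists (maxn n1 n2) => n; rewrite geq_max => /andP[/n1P nn1 /n2P nn2].
have sub : L `\` stop L T `<=` [set x | L x /\ (d ^ k <= multiplier k x)%N]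
    `|` (L `&` closed_ball_ Num.norm 0 rho).
  move=> x [Lx nx].
  have [dM|Md] := leqP (d ^ k) (multiplier k x); [by left|right].
  split=> //; apply/closed_ball0P; rewrite leNgt; apply/negP => rx.
  by apply: nx; split=> //; exact: rhoP Md rx.
set X := [set x | _] in sub.
have XL : X `<=` L by move=> x [].
have YL : L `&` closed_ball_ Num.norm 0 rho `<=` L by move=> x [].
apply: le_trans (_ : _ <= (ball_count X n%:R + ball_count L rho)%:R) _.
  rewrite ler_nat; apply: leq_trans (leq_count _ sub (lexx _)) _.
    by move=> x [/XL|/YL].
  apply: leq_trans (count_setU _ XL YL) _; rewrite leq_add2l.
  rewrite /ball_count; apply/fsubset_leq_card; rewrite -fset_set_sub.
  - by move=> x [].
  - exact: finite_sub_ball.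
  - exact: finite_sub_ball.
rewrite natrD (splitr eps) mulrDl lerD//.
  apply: le_trans (qP _ _) _.
  apply: le_trans (ler_wpM2r _ qk); rewrite // -mulrA ler_wpM2l ?exprn_ge0//.
  by rewrite -natrM ler_nat.
rewrite mulrC -ler_pdivrMr ?divr_gt0//.
rewrite (le_trans (ltW (archi_boundP _)))//; last by rewrite ler_nat.
by rewrite mulr_ge0// invr_ge0 divr_ge0// ltW.
Qed.

Lemma has_density_stop : (0 < e)%N ->
  (\big[muln/1%N]_(w \in quotient L d) m w < d ^ (d ^ e))%N ->
  has_density L (stop L T) 1.
Proof.
rewrite prod_quotient => e0 /(count_nonstop e0) nonstop.
suff /cvg_limn_einf_sup[inf1 sup1] :
    (ball_ratio L (stop L T) n)%:E @[n --> \oo] --> 1%:E by split.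
apply: cvg_EFin; first exact: nearW.
apply/cvgrPdist_le => eps eps0.
have [n0 n0P] := nonstop _ eps0.
exists n0 => // n /= /n0P.
have countE Z : count_in_ball Z n = ball_count Z n%:R by [].
rewrite /ball_ratio !countE.
have SL : stop L T `<=` L by move=> x [].
have : (0 < ball_count L n%:R)%N.
  rewrite /ball_count cardfs_gt0; apply/fset0Pn; exists 0.
  rewrite in_fset_set ?inE; last exact: finite_sub_ball.
  by split; [exact: intSpan0|apply/closed_ball0P; rewrite normr0].
rewrite -(ltr0n R) (count_setD _ (@subset_refl _ L) SL) natrD => c0 nS.
rewrite -{1}(divff (lt0r_neq0 c0)) -mulrBl addrAC subrr add0r.
by rewrite ger0_norm ?ler_pdivrMr// divr_ge0// ltW.
Qed.

End Dynamics.
End Lattice.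

Theorem theorem3 (R : realType) (E : normedVectType R) (e : nat)
    (dimE : \dim {:E} = e) (e_ge1 : (1 <= e)%N)
    (L : set E) (latL : is_lattice L)
    (d : nat) (d_gt1 : (1 < d)%N)
    (m : set E -> nat) (r : set E -> E)
    (mrP : collatz_data L d m r)
    (cop : relatively_prime_type L d m)
    (prod_lt : (\big[muln/1%N]_(w \in quotient L d) m w < d ^ (d ^ e))%N) :
  has_density L (stop L (collatz L d m r)) 1.
Proof.
case: latL => b bP LE; rewrite LE in mrP cop prod_lt *.
rewrite -dimE in e_ge1 prod_lt; exact: has_density_stop.
Qed.
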